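(* Let $k$ be a finite field of order $q$ and characteristic $2$. There are infinitely many maximal $T$-spaces of $k[x]_0$ that contain $\{x+x^q\}^S$.
   Context: $k[x]_0=xk[x]$ denotes the free (nonunitary) associative $k$-algebra on one generator $x$. A $T$-space of an associative $k$-algebra $A$ is a $k$-linear subspace of $A$ invariant under every $k$-algebra endomorphism of $A$; for $H\subseteq A$, $H^S$ denotes the smallest $T$-space of $A$ containing $H$. A maximal $T$-space is a maximal element, under inclusion, among the proper $T$-spaces. *)

(* Defs.v *)
From HB Require Import structures.
From mathcomp Require Import all_boot all_order all_algebra.
From mathcomp Require Import boolp classical_sets functions cardinality.

Set Implicit Arguments.
Unset Strict Implicit.
Unset Printing Implicit Defensive.

Import GRing.Theory.

Local Open Scope ring_scope.

(* MathComp's algType structures all carry a unit; this is an associative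
   k-algebra without one. *)
HB.mixin Record Lmodule_isNUAlgebra (k : comNzRingType) A
    of GRing.Lmodule k A := {
  numul : A -> A -> A;
  numulA : associative numul;
  numulDl : left_distributive numul +%R;
  numulDr : right_distributive numul +%R;
  numulZl : forall (a : k) (x y : A), numul (a *: x) y = a *: numul x y;
  numulZr : forall (a : k) (x y : A), numul x (a *: y) = a *: numul x y
}.

#[short(type="nuAlgType")]
HB.structure Definition NUAlgebra (k : comNzRingType) :=
  {A of Lmodule_isNUAlgebra k A & GRing.Lmodule k A}.

(* x * ... * x with n factors.  There being no unit, only n > 0 is meaningful;
   the value at n = 0 is 0 by convention. *)
Definition nuexp (k : comNzRingType) (A : nuAlgType k) (x : A) (n : nat) : A :=
  iterop n numul x 0.

Section TSpace.
Variables (k : comNzRingType) (A : nuAlgType k).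

Definition nu_endomorphism (f : {linear A -> A}) : Prop :=
  {morph f : x y / numul x y}.

Definition Tspace (U : set A) : Prop :=
  submod_closed (mem U) /\
  forall f : {linear A -> A}, nu_endomorphism f -> (f @` U `<=` U)%classic.

Definition Tspan (H : set A) : set A := smallest Tspace H.

Definition maximal_Tspace (M : set A) : Prop :=
  [/\ Tspace M, M <> [set: A]%classic &
    forall U : set A, Tspace U -> U <> [set: A]%classic ->
      (M `<=` U)%classic -> U = M].

Lemma Tspan_Tspace (H : set A) : Tspace (Tspan H).
Proof.
split=> [|f fM _ [u Hu <-] V VP]; last first.
  by case: (VP) => [[_ Vf] _]; apply: (Vf f fM); exists u; [apply: Hu|].
split=> [|a u v]; rewrite !in_setE.
  by move=> V [[[V0 _] _] _]; rewrite in_setE in V0.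
move=> Hu Hv V VP; case: (VP) => [[[_ VD] _] _].
by have := VD a u v; rewrite !in_setE; apply; [apply: Hu|apply: Hv].
Qed.

End TSpace.

Section XPoly.
Variable k : fieldType.

Definition xpoly_pred : {pred {poly k}} := [pred p | 'X %| p].

Fact xpoly_submod_closed : submod_closed xpoly_pred.
Proof.
split=> [|a p r]; rewrite !inE; first exact: dvdp0.
by move=> Xp Xr; apply: dvdp_add => //; rewrite -mul_polyC dvdp_mull.
Qed.

HB.instance Definition _ :=
  GRing.isSubmodClosed.Build k {poly k} xpoly_pred xpoly_submod_closed.

(* k[x]_0 = x k[x] *)
Record xpoly := XPoly { xpoly_val :> {poly k}; _ : xpoly_val \in xpoly_pred }.

HB.instance Definition _ := [isSub for xpoly_val].
HB.instance Definition _ := [Choice of xpoly by <:].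
HB.instance Definition _ := [SubChoice_isSubLmodule of xpoly by <:].

Fact xpoly_mul_subproof (p r : xpoly) : (p : {poly k}) * r \in xpoly_pred.
Proof. by rewrite inE dvdp_mulr //; apply: (valP p). Qed.

Definition xpoly_mul (p r : xpoly) : xpoly := XPoly (xpoly_mul_subproof p r).

Fact xpoly_mulA : associative xpoly_mul.
Proof. by move=> p r s; apply: val_inj; rewrite /= mulrA. Qed.

Fact xpoly_mulDl : left_distributive xpoly_mul +%R.
Proof. by move=> p r s; apply: val_inj; rewrite /= mulrDl. Qed.

Fact xpoly_mulDr : right_distributive xpoly_mul +%R.
Proof. by move=> p r s; apply: val_inj; rewrite /= mulrDr. Qed.

Fact xpoly_mulZl (a : k) (p r : xpoly) :
  xpoly_mul (a *: p) r = a *: xpoly_mul p r.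
Proof. by apply: val_inj; rewrite /= scalerAl. Qed.

Fact xpoly_mulZr (a : k) (p r : xpoly) :
  xpoly_mul p (a *: r) = a *: xpoly_mul p r.
Proof. by apply: val_inj; rewrite /= scalerAr. Qed.

HB.instance Definition _ := Lmodule_isNUAlgebra.Build k xpoly
  xpoly_mulA xpoly_mulDl xpoly_mulDr xpoly_mulZl xpoly_mulZr.

Fact xpolyX_subproof : 'X \in xpoly_pred.
Proof. by rewrite inE dvdpp. Qed.

Definition xpolyX : xpoly := XPoly xpolyX_subproof.

Lemma xpoly_val_exp (p : xpoly) (n : nat) :
  (0 < n)%N -> xpoly_val (nuexp p n) = (p : {poly k}) ^+ n.
Proof.
case: n => // n _; elim: n => [|n IHn]; first by rewrite expr1.
by rewrite [RHS]exprS -IHn.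
Qed.

End XPoly.

(* Main.v *)
Require Import Defs.
From HB Require Import structures.
From mathcomp Require Import all_boot all_order all_algebra.
From mathcomp Require Import boolp classical_sets functions cardinality.
From mathcomp Require Import fingroup pgroup abelian finfield.

(** Write q for the order of k.  For m > 0, the polynomials f of k[x]_0 whose
    values on the field with q^m elements all have trace 0 over k form a
    T-space V_m: a substitution only replaces the points at which f is
    evaluated by other points of the same field.  It contains x - x^q, since
    conjugate elements have the same trace, and it does not contain x, since
    the trace is not identically zero.  As x generates k[x]_0 as a T-space,
    Zorn's lemma puts V_m inside a maximal T-space.

    Two of these T-spaces can be far apart.  Let K be the field with q^d
    elements, and L its extension of degree c, where the characteristic
    divides c.  The trace from L to k vanishes on K, because on K it is c times
    the trace from K to k.  Let f be the polynomial x (x^(q^d) - x)^(q^(dc) - 1):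
    its values on L are f(a) = 0 for a in K, and f(a) = a for the other a.
    Hence f lies in V_d, whereas x - f, whose values on L are all in K, lies in
    V_(dc) ([trace_spaces_comaximal]).  So no proper T-space contains both V_d
    and V_(dc).  In characteristic 2 this applies to any two of the spaces
    V_(2^n), and the maximal T-spaces above them are pairwise distinct.

    No extension field is constructed below: a polynomial vanishes on the field
    with q^m elements if and only if it is a multiple of x^(q^m) - x, so values
    on that field are treated as residues modulo this polynomial, and the trace
    of f as the sum of the powers f^(q^i) for i < m. *)

Local Open Scope ring_scope.
Import GRing.Theory.

(** * T-spaces and maximal T-spaces *)

Section TspaceTheory.
Variables (k : comNzRingType) (A : nuAlgType k).
Implicit Types (U V : set A) (a u v : A).

Lemma Tspace0 U : Tspace U -> U 0.
Proof. by case=> [[U0 _] _]; rewrite in_setE in U0. Qed.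

Lemma TspaceD U u v : Tspace U -> U u -> U v -> U (u + v).
Proof.
case=> [[_ UD] _] Uu Uv; have := UD 1 u v.
by rewrite !in_setE scale1r; apply.
Qed.

(** The union of the empty chain is not a T-space; Zorn's lemma is therefore
    applied to the sets that become T-spaces once V is added to them. *)
Lemma exists_maximal_Tspace a V :
    (forall U, Tspace U -> U a -> U = [set: A]%classic) ->
    Tspace V -> ~ V a ->
  exists2 M, maximal_Tspace M & (V `<=` M)%classic.
Proof.
move=> gen_a TV Va.
pose P (B : set A) := Tspace (V `|` B)%classic /\ ~ (V `|` B)%classic a.
have [|B [[TB Ba] maxB]] := @Zorn_bigcup A P.
  move=> F FP Ftot; split; last first.
    by case=> // -[X FX Xa]; have [_] := FP X FX; apply; right.
  have VX (X : set A) : F X -> Tspace (V `|` X)%classic.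
    by move=> FX; have [] := FP X FX.
  split; last first.
    move=> f fM _ [u [Vu|[X FX Xu]] <-].
      by left; case: TV => _ /(_ f fM); apply; exists u.
    have [_ /(_ f fM) stabX] := VX X FX.
    have [|Vfu|Xfu] := stabX (f u); first by exists u; [right|].
      by left.
    by right; exists X.
  split=> [|c u v]; rewrite !in_setE; first by left; apply: Tspace0.
  have closedX (X : set A) : F X -> (V `|` X)%classic u ->
      (V `|` X)%classic v -> (V `|` \bigcup_(X in F) X)%classic (c *: u + v).
    move=> FX Xu Xv; have [[_ linX] _] := VX X FX.
    have := linX c u v; rewrite !in_setE => /(_ Xu Xv) [Vw|Xw]; first by left.
    by right; exists X.
  move=> [Vu|[X FX Xu]] [Vv|[Y FY Yv]].
  - left; case: (TV) => -[_ linV] _.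
    by have := linV c u v; rewrite !in_setE; apply.
  - by apply: (closedX Y) => //; [left|right].
  - by apply: (closedX X) => //; [right|left].
  - by have [XY|YX] := Ftot X Y FX FY;
      [apply: (closedX Y) => //|apply: (closedX X) => //]; right; auto.
exists (V `|` B)%classic; last exact: subsetUl.
split=> // [VB|U TU U_neqT VBU]; first by apply: Ba; rewrite VB.
have VU : (V `|` U)%classic = U.
  by apply/setUidPr; apply: subset_trans VBU; apply: subsetUl.
apply/seteqP; split=> // u Uu; apply: contrapT => VBu.
apply: (maxB U); last by split; rewrite VU // => Ua; apply: U_neqT; apply: gen_a.
split; last by move=> UB; apply: VBu; right; apply: UB.
by apply: subset_trans VBU; apply: subsetUr.
Qed.

End TspaceTheory.

(** * Endomorphisms of k[x]_0 *)

Section Endomorphisms.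
Variable k : fieldType.
Implicit Types (p g : xpoly k) (r : {poly k}).

Lemma xpoly_mulX_subproof r : r * 'X \in @xpoly_pred k.
Proof. by rewrite inE dvdp_mull. Qed.

Definition xpoly_mulX r : xpoly k := XPoly (xpoly_mulX_subproof r).

Lemma xpolyE p : {r | p = xpoly_mulX r}.
Proof.
have Xp : 'X %| val p by exact: (valP p).
by exists (val p %/ 'X); apply: val_inj; rewrite /= divpK.
Qed.

Lemma xpoly_mulX_MXaddC r c :
  xpoly_mulX (r * 'X + c%:P) = numul (xpoly_mulX r) (xpolyX k) + c *: xpolyX k.
Proof. by apply: val_inj; rewrite /= mulrDl mul_polyC. Qed.

(** There is no constant term to start an induction from, so the induction runs
    on the cofactor of x in p. *)
Lemma nu_endomorphism_comp (f : {linear xpoly k -> xpoly k}) p :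
  nu_endomorphism f -> (f p : {poly k}) = val p \Po val (f (xpolyX k)).
Proof.
move=> fM; have [r ->] := xpolyE p.
elim/poly_ind: r => [|r c IHr].
  have ->: xpoly_mulX 0 = 0 by apply: val_inj; rewrite /= mul0r.
  by rewrite linear0 /= comp_poly0.
rewrite xpoly_mulX_MXaddC linearD linearZ fM /= IHr /=.
by rewrite comp_polyD comp_polyZ !comp_polyM comp_polyX.
Qed.

Lemma comp_xpoly_subproof g r : r \in @xpoly_pred k ->
  r \Po val g \in @xpoly_pred k.
Proof.
rewrite !inE => /(dvdp_comp_poly (val g)); rewrite comp_polyX.
by apply: dvdp_trans; apply: (valP g).
Qed.

Definition comp_xpoly g p : xpoly k := XPoly (comp_xpoly_subproof g _ (valP p)).

Fact comp_xpoly_is_linear g : linear (comp_xpoly g).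
Proof.
by move=> c p r; apply: val_inj; rewrite /= comp_polyD comp_polyZ.
Qed.

HB.instance Definition _ g :=
  GRing.isLinear.Build k (xpoly k) (xpoly k) _ (comp_xpoly g)
    (comp_xpoly_is_linear g).

Lemma xpolyX_generates (U : set (xpoly k)) :
  Tspace U -> U (xpolyX k) -> U = [set: xpoly k]%classic.
Proof.
case=> _ stabU UX; apply/seteqP; split=> // g _.
have gM : nu_endomorphism (comp_xpoly g).
  by move=> p r; apply: val_inj; rewrite /= comp_polyM.
apply: (stabU _ gM); exists (xpolyX k) => //.
by apply: val_inj; rewrite /= comp_polyX.
Qed.

End Endomorphisms.

(** * Trace polynomials *)

Section Trace.
Variable k : finFieldType.
Local Notation q := #|{: k}|.
Implicit Types (p f g : {poly k}) (d m i : nat).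

Lemma expn_card_gt0 i : (0 < q ^ i)%N.
Proof. by rewrite expn_gt0 ltnW ?finNzRing_gt1. Qed.

Lemma card_finField_pnat : [pchar {poly k}].-nat q.
Proof.
have [p p_pr pchar_k] := finPcharP k.
have /abelem_pgroup := fin_ring_pchar_abelem pchar_k.
rewrite /pgroup cardsT; apply: sub_in_pnat => r _ /eqP->.
by rewrite pchar_poly.
Qed.

Lemma expq_pnat i : [pchar {poly k}].-nat (q ^ i)%N.
Proof. by rewrite pnatX card_finField_pnat. Qed.

Lemma expqD i f g : (f + g) ^+ (q ^ i) = f ^+ (q ^ i) + g ^+ (q ^ i).
Proof. exact: exprDn_pchar (expq_pnat i). Qed.

Lemma expqN i f : (- f) ^+ (q ^ i) = - f ^+ (q ^ i).
Proof. exact: exprNn_pchar (expq_pnat i). Qed.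

Lemma expf_card_iter i (c : k) : c ^+ (q ^ i) = c.
Proof. by elim: i => // i IHi; rewrite expnSr exprM IHi expf_card. Qed.

Lemma expqZ i (c : k) f : (c *: f) ^+ (q ^ i) = c *: f ^+ (q ^ i).
Proof. by rewrite exprZn expf_card_iter. Qed.

(** The values of p on the field with q^m elements stay in this field. *)
Lemma dvdp_expq_sub m p : 'X^(q ^ m) - 'X %| p ^+ (q ^ m) - p.
Proof.
elim/poly_ind: p => [|r c IHr].
  by rewrite expr0n gtn_eqF ?expn_card_gt0 // subrr dvdp0.
rewrite expqD exprMn -polyC_exp expf_card_iter opprD addrACA subrr addr0.
have ->: r ^+ (q ^ m) * 'X^(q ^ m) - r * 'X
  = (r ^+ (q ^ m) - r) * 'X^(q ^ m) + r * ('X^(q ^ m) - 'X).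
  by rewrite mulrBl mulrBr addrA subrK.
by apply: dvdp_add; [apply: dvdp_mulr | apply: dvdp_mull].
Qed.

Definition trace_poly m f : {poly k} := \sum_(i < m) f ^+ (q ^ i).

Fact trace_poly_is_linear m : linear (trace_poly m).
Proof.
move=> c f g; rewrite /trace_poly scaler_sumr -big_split /=.
by apply: eq_bigr => i _; rewrite expqD expqZ.
Qed.

HB.instance Definition _ m :=
  GRing.isLinear.Build k {poly k} {poly k} _ (trace_poly m)
    (trace_poly_is_linear m).

Lemma trace_poly_comp m f g : trace_poly m f \Po g = trace_poly m (f \Po g).
Proof.
by rewrite /trace_poly linear_sum; apply: eq_bigr => i _; rewrite rmorphXn.
Qed.

Lemma dvdp_trace_poly m (P : {poly k}) f : P %| f -> P %| trace_poly m f.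
Proof.
move=> Pf; apply: (big_ind (fun h => P %| h)) => [|h1 h2|i _].
- exact: dvdp0.
- exact: dvdp_add.
- exact: dvdp_exp (expn_card_gt0 i) Pf.
Qed.

Lemma trace_polyD d m f :
  trace_poly (d + m) f = trace_poly d f + trace_poly m (f ^+ (q ^ d)).
Proof.
rewrite /trace_poly big_split_ord; congr (_ + _).
by apply: eq_bigr => i _; rewrite expnD exprM.
Qed.

(** An element fixed by the d-th power of the Frobenius automorphism has a trace
    that repeats the same d terms c times. *)
Lemma trace_poly_mul (P : {poly k}) d c f : P %| f ^+ (q ^ d) - f ->
  P %| trace_poly (d * c) f - trace_poly d f *+ c.
Proof.
move=> Pf; elim: c => [|c IHc].
  by rewrite muln0 /trace_poly big_ord0 mulr0n subrr dvdp0.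
rewrite mulnS trace_polyD mulrS opprD addrACA subrr add0r.
rewrite -[X in trace_poly _ X](subrK f) linearD /= -addrA.
by apply: dvdp_add => //; apply: dvdp_trace_poly.
Qed.

Lemma trace_poly_X_neq0 m : (0 < m)%N -> trace_poly m 'X != 0.
Proof.
case: m => // m _; apply/eqP => /(congr1 (fun p : {poly k} => p`_1)).
rewrite /trace_poly big_ord_recl expn0 expr1 coefD coefX coef_sum coef0 big1.
  by rewrite addr0 => /eqP; rewrite oner_eq0.
move=> i _; rewrite coefXn ltn_eqF //=.
by rewrite -(exp1n (lift ord0 i)) ltn_exp2r // finNzRing_gt1.
Qed.

Lemma size_trace_poly_X m : (size (trace_poly m 'X) <= q ^ m)%N.
Proof.
apply: leq_trans (size_sum _ _ _) _; apply/bigmax_leqP => i _.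
by rewrite size_polyXn ltn_exp2l // finNzRing_gt1.
Qed.

Lemma trace_poly_sub_expq m f : trace_poly m (f ^+ q - f) = f ^+ (q ^ m) - f.
Proof.
rewrite /trace_poly; under eq_bigr do rewrite expqD expqN -exprM -expnS.
rewrite -(big_mkord xpredT (fun i => f ^+ (q ^ i.+1) - f ^+ (q ^ i))).
by rewrite telescope_sumr // expn0 expr1.
Qed.

End Trace.

(** * The T-spaces of polynomials with vanishing trace *)

Section TraceSpace.
Variable k : finFieldType.
Local Notation q := #|{: k}|.
Implicit Types (d m : nat).

(** The polynomials whose values on the field with q^m elements have trace 0
    over k. *)
Definition trace_space m : set (xpoly k) :=
  [set f | 'X^(q ^ m) - 'X %| trace_poly k m (xpoly_val f)]%classic.

(** For an endomorphism that sends x to g, the trace polynomial of p(g) is that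
    of p composed with g, hence a multiple of g^(q^m) - g. *)
Lemma trace_space_Tspace m : Tspace (trace_space m).
Proof.
split=> [|f fM _ [p Vp <-]].
  split=> [|c p r]; rewrite !in_setE /trace_space /=.
    by rewrite linear0 dvdp0.
  move=> Vp Vr; rewrite linearP; apply: dvdp_add => //=.
  by rewrite -mul_polyC dvdp_mull.
rewrite /trace_space /= nu_endomorphism_comp // -trace_poly_comp.
apply: dvdp_trans (dvdp_comp_poly _ Vp).
rewrite comp_polyB rmorphXn /= comp_polyX; exact: dvdp_expq_sub.
Qed.

(** The trace polynomial of x is nonzero, of degree less than q^m. *)
Lemma trace_space_X m : (0 < m)%N -> ~ trace_space m (xpolyX k).
Proof.
move=> m_gt0 /(dvdp_leq (trace_poly_X_neq0 k m m_gt0)) leXt.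
have := leq_trans leXt (size_trace_poly_X k m).
have q_gt1 := finNzRing_gt1 k.
rewrite size_polyDl ?size_polyXn ?ltnn // size_polyN size_polyX ltnS.
by have := ltn_exp2l 0 m q_gt1; rewrite expn0 => ->.
Qed.

Lemma trace_space_expq_sub m :
  trace_space m (nuexp (xpolyX k) q - xpolyX k).
Proof.
have q_gt0 : (0 < q)%N := ltnW (finNzRing_gt1 k).
by rewrite /trace_space /= xpoly_val_exp //= trace_poly_sub_expq.
Qed.

(** In characteristic p this applies when p divides c.  Then x is the sum of
    f, which kills the field K with q^d elements, and x - f, which maps the
    field with q^(dc) elements into K, where the trace of the larger field is c
    times that of K. *)
Lemma trace_spaces_comaximal d c : (0 < d)%N -> (0 < c)%N ->
    c%:R = 0 :> k ->
  exists f, trace_space d f /\ trace_space (d * c) (xpolyX k - f).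
Proof.
move=> d_gt0 c_gt0 c0.
set Q := (q ^ d)%N; set R := (q ^ (d * c))%N.
pose P : {poly k} := 'X^Q - 'X; pose e : {poly k} := 1 - P ^+ R.-1.
have R_gt1 : (1 < R)%N.
  have := ltn_exp2l 0 (d * c) (finNzRing_gt1 k).
  by rewrite expn0 => ->; rewrite muln_gt0 d_gt0.
have R1_gt0 : (0 < R.-1)%N by case: (R) R_gt1 => [|[]].
exists (xpoly_mulX k (P ^+ R.-1)); split; rewrite /trace_space /=.
  by apply/dvdp_trace_poly/dvdp_mulr/dvdp_exp.
have ->: 'X - P ^+ R.-1 * 'X = e * 'X by rewrite mulrBl mul1r.
(* e is the indicator function of the subfield with Q elements. *)
have dvd_eP : 'X^R - 'X %| e * P.
  rewrite mulrBl mul1r -exprSr prednK ?(ltnW R_gt1) // -dvdpNr opprB.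
  exact: dvdp_expq_sub.
have idem_e : 'X^R - 'X %| e * e - e.
  have ->: e * e - e = - (e * P) * P ^+ R.-2.
    rewrite mulNr -mulrA -exprS (prednK R1_gt0) -[X in _ - X]mulr1 -mulrBr.
    have ->: e - 1 = - P ^+ R.-1 by rewrite /e addrAC subrr sub0r.
    by rewrite mulrN.
  by rewrite dvdp_mulr // dvdpNr.
have exp_e n : 'X^R - 'X %| e ^+ n.+1 - e.
  elim: n => [|n IHn]; first by rewrite subrr dvdp0.
  have ->: e ^+ n.+2 - e = e * (e ^+ n.+1 - e) + (e * e - e).
    by rewrite exprS mulrBr addrA subrK.
  by apply: dvdp_add => //; apply: dvdp_mull.
(* Hence e x takes its values in this subfield. *)
have fixed : 'X^R - 'X %| (e * 'X) ^+ Q - e * 'X.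
  have ->: (e * 'X) ^+ Q - e * 'X = (e ^+ Q - e) * 'X^Q + e * P.
    by rewrite exprMn [(_ - e) * _]mulrBl /P [e * (_ - _)]mulrBr addrA subrK.
  apply: dvdp_add => //; apply: dvdp_mulr.
  by rewrite -[Q](prednK (expn_card_gt0 k d)); apply: exp_e.
have := trace_poly_mul k _ _ c _ fixed.
by rewrite -scaler_nat c0 scale0r subr0.
Qed.

End TraceSpace.

Theorem corollary4p2 (k : finFieldType) (q : nat)
    (kq : #|{: k}| = q) (k2 : 2%N \in [pchar k]) :
  let x := xpolyX k in
  infinite_set [set M : set (xpoly k) |
    maximal_Tspace M /\ Tspan [set x + nuexp x q] `<=` M]%classic.
Proof.
move=> x; rewrite -kq.
have X_notin n : ~ trace_space k (2 ^ n) x.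
  by apply: trace_space_X; rewrite expn_gt0.
have /choice[M maxM] n : exists M,
    maximal_Tspace M /\ (trace_space k (2 ^ n) `<=` M)%classic.
  have [M] := exists_maximal_Tspace _ _ x _ (xpolyX_generates k)
    (trace_space_Tspace k (2 ^ n)) (X_notin n).
  by exists M.
have ltM n m : (n < m)%N -> M n <> M m.
  move=> lt_nm eqM; have [[TM M_proper _] VnM] := maxM n.
  have [f [Vn_f Vm_Xf]] : exists f,
      trace_space k (2 ^ n) f /\ trace_space k (2 ^ m) (x - f).
    rewrite -(subnKC (ltnW lt_nm)) expnD.
    apply: trace_spaces_comaximal; rewrite ?expn_gt0 //.
    by rewrite natrX (pcharf0 k2) expr0n gtn_eqF // subn_gt0.
  apply/M_proper/(xpolyX_generates _ _ TM).
  rewrite -/x -(subrK f x); apply: TspaceD => //; last exact: VnM.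
  by rewrite eqM; apply: (maxM m).2.
have injM : injective M.
  by move=> n m eqM; case: (ltngtP n m) => // /ltM; rewrite eqM.
move=> finM; apply: infinite_nat.
apply: sub_finite_set (finite_preimage (f := M) (in2W injM) finM) => n _.
have [maxMn VnM] := maxM n; split=> // g; apply; split; first by case: maxMn.
move=> _ ->; apply: VnM.
have ->: x + nuexp x #|{: k}| = nuexp x #|{: k}| - x.
  rewrite addrC; congr (_ + _).
  by apply: val_inj; rewrite /= oppr_pchar2 // pchar_poly.
exact: trace_space_expq_sub.
Qed.
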